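(* Let $(a_k)_{k\ge1}$ be a sequence of positive integers. If there exists an integer $m\ge0$ such that the infinite word $a_{m+1}a_{m+2}\ldots$ is recurrent, then, for every sequence $\mathcal{D}$ of integers greater than or equal to $2$, the real number $\alpha:=[0;a_1,a_2,\ldots]$ satisfies $$\inf_{q\ge1}\; q\cdot\Vert q\alpha\Vert\cdot|q|_{\mathcal{D}}=0,$$ where the infimum is over positive integers $q$.
   Context: $\Vert x\Vert$ denotes the distance from the real number $x$ to the nearest integer. $[0;a_1,a_2,\ldots]$ denotes the continued fraction with partial quotients $a_1,a_2,\ldots$. An infinite word is recurrent if every finite block (of consecutive letters) occurring in it occurs infinitely often. For a sequence $\mathcal{D}=(d_k)_{k\ge1}$ of integers $\ge2$ set $e_0=1$ and $e_n=\prod_{1\le k\le n}d_k$ for $n\ge1$; for a positive integer $q$ set $w_{\mathcal{D}}(q)=\sup\{n\ge0: q\in e_n\mathbf{Z}\}$ and $|q|_{\mathcal{D}}=1/e_{w_{\mathcal{D}}(q)}=\inf\{1/e_n: q\in e_n\mathbf{Z}\}$. *)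

(* Defs.v *)
From HB Require Import structures.
From mathcomp Require Import all_boot all_order all_algebra.
From mathcomp Require Import all_classical all_reals all_analysis.

Set Implicit Arguments.
Unset Strict Implicit.
Unset Printing Implicit Defensive.

Import Order.TTheory GRing.Theory Num.Theory.
Import numFieldNormedType.Exports.

Local Open Scope classical_set_scope.
Local Open Scope ring_scope.

(* Sequences written (x_k)_{k>=1} in the mathematics are functions on nat whose
   value at 0 is never used. *)

Section Words.
Variable T : Type.

Definition occurs_at (w : nat -> T) (u : seq T) (i : nat) : Prop :=
  [seq w j | j <- iota i (size u)] = u.

Definition recurrent (w : nat -> T) : Prop :=
  forall u : seq T, (exists i, occurs_at w u i) ->
    infinite_set [set i | occurs_at w u i].

End Words.

Section DiophantineApproximation.
Variable R : realType.

(* fin_cfrac [:: a1; ...; an] = [0; a1, ..., an] *)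
Definition fin_cfrac (s : seq nat) : R :=
  foldr (fun (b : nat) (x : R) => (b%:R + x)^-1) 0 s.

Definition cfrac (a : nat -> nat) : R :=
  limn (fun n => fin_cfrac [seq a k | k <- iota 1 n]).

Definition dist_int (x : R) : R := inf [set `|x - z%:~R| | z in [set: int]].

Definition eprod (d : nat -> nat) (n : nat) : nat :=
  (\prod_(1 <= k < n.+1) d k)%N.

Definition absD (d : nat -> nat) (q : nat) : R :=
  inf [set (eprod d n)%:R^-1 | n in [set n | (eprod d n %| q)%N]].

End DiophantineApproximation.

(* Main.v *)
(* Modulo e = e_N, the pair (q_n, q_(n-1)) evolves by permutations of (Z/e)^2
   chosen by the partial quotients. Recurrence of the word makes the product of
   these permutations along some long block a_(m+1) ... a_n the identity, so
   (q_n, q_(n-1)) and (q_m, q_(m-1)) agree modulo e. Then e divides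
   q = |q_m q_(n-1) - q_(m-1) q_n|, which is nonzero because q_n > q_m is coprime
   to q_(n-1), while q ||q alpha|| <= (q_m + q_(m-1))^2 independently of N. *)
Require Import Defs.
From HB Require Import structures.
From mathcomp Require Import all_boot all_order all_algebra all_fingroup.
From mathcomp Require Import all_classical all_reals all_analysis.
From mathcomp Require Import ring.

Set Implicit Arguments.
Unset Strict Implicit.
Unset Printing Implicit Defensive.

Import Order.TTheory GRing.Theory Num.Theory.
Import numFieldNormedType.Exports.

Local Open Scope classical_set_scope.
Local Open Scope ring_scope.

(** * Return times in recurrent words *)

Lemma recurrent_prefix T (w : nat -> T) (K L : nat) : recurrent w ->
  exists2 i, (K <= i)%N & forall t, (t < L)%N -> w (i + t)%N = w t.
Proof.
move=> wrec; pose u := [seq w j | j <- iota 0 L].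
have uw : exists i, occurs_at w u i by exists 0%N; rewrite /occurs_at size_map size_iota.
(* The prefix occurs at 0, hence at infinitely many positions, of which only finitely many lie below
   [K]. *)
have [i [/= ui /negP]] := infinite_setN0 (infinite_setD (wrec u uw) (finite_II K)).
rewrite -leqNgt => Ki; exists i => // t tL.
have := congr1 (fun s => nth (w 0%N) s t) ui.
by rewrite /u size_map size_iota !(nth_map 0%N) ?size_iota // !nth_iota.
Qed.

(* Furstenberg: with n_k a return time of the prefix of length
   n_1 + ... + n_(k-1), the product along n_k + ... + n_1 is g_k ... g_1,
   where g_i is the product along n_i; two of these coincide. *)
Lemma recurrent_prod1 T (w : nat -> T) (gT : finGroupType) (f : T -> gT) (K : nat) :
  recurrent w ->
  exists2 n, (K <= n)%N & (\prod_(0 <= j < n) f (w j))%g = 1%g.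
Proof.
move=> wrec; pose P n := (\prod_(0 <= j < n) f (w j))%g.
have [r rP] : {r : nat -> nat & forall L,
    (K <= r L)%N /\ forall t, (t < L)%N -> w (r L + t)%N = w t}.
  apply: (@choice _ _ (fun L i => (K <= i)%N /\
     forall t, (t < L)%N -> w (i + t)%N = w t)) => L.
  by have [i Ki iP] := recurrent_prefix K L wrec; exists i.
have PD L s : (s <= L)%N -> P (r L + s)%N = (P (r L) * P s)%g.
  move=> sL; rewrite /P (big_cat_nat _ (n := r L)) ?leq_addr //=.
  congr (_ * _)%g; rewrite -{1}[r L]add0n big_addn addnC addnK.
  apply: eq_big_nat => j /andP[_ js].
  by rewrite addnC (rP L).2 // (leq_trans js).
pose S := fix S k := if k is k'.+1 then (r (S k') + S k')%N else 0%N.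
have Smono : {homo S : k l / (k <= l)%N}.
  by apply: homo_leq => // [x y z|k]; [exact: leq_trans|rewrite leq_addl].
(* As [S k - S l <= S k], the block at [r (S k)] repeats the prefix of that length. So adding
   [r (S k)] to the length multiplies both [P (S k - S l)] and [P (S k)] on the left by
   [P (r (S k))]. *)
have PB k l : (l <= k)%N -> P (S k - S l)%N = (P (S k) * (P (S l))^-1)%g.
  elim: k => [|k IHk].
    by rewrite leqn0 => /eqP->; rewrite subnn mulgV /P big_geq.
  rewrite leq_eqVlt => /predU1P[->|lk].
    by rewrite subnn mulgV /P big_geq.
  by rewrite /= -addnBA ?Smono // !PD ?leq_subr // IHk // mulgA.
have [k [l lk PE]] : exists k, exists2 l, (l < k)%N & P (S l) = P (S k).
  pose h (i : 'I_#|gT|.+1) := P (S i).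
  have /injectivePn[x [y xy hxy]] : ~~ injectiveb h.
    by apply/negP => /injectiveP /leq_card; rewrite card_ord ltnn.
  have [xly|ylx|/ord_inj xey] := ltngtP x y; last by rewrite xey eqxx in xy.
    by exists y, x.
  by exists x, y.
exists (S k - S l)%N; last by have := PB _ _ (ltnW lk); rewrite PE mulgV.
(* Since [l < k], the difference is at least the single return time [r (S l)]. *)
apply: leq_trans (rP (S l)).1 _.
by rewrite leq_subRL ?Smono ?(ltnW lk) // addnC; exact: Smono lk.
Qed.

(* [cf_pair a (1, 0) n] is [(q_n, q_(n-1))] and [cf_pair a (0, 1) n] is
   [(p_n, p_(n-1))], where [p_n / q_n] is the n-th convergent. *)
Fixpoint cf_pair (a : nat -> nat) (x : nat * nat) (n : nat) : nat * nat :=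
  if n is n'.+1 then
    let y := cf_pair a x n' in ((a n * y.1 + y.2)%N, y.1)
  else x.

Notation qpair a := (cf_pair a (1, 0)%N).
Notation ppair a := (cf_pair a (0, 1)%N).

(** * The continued fraction recursion modulo e *)

Section CfStepPerm.
Variable e : nat.

Definition cf_step (b : nat) (x : 'Z_e * 'Z_e) : 'Z_e * 'Z_e :=
  (b%:R * x.1 + x.2, x.1).

Lemma cf_step_inj b : injective (cf_step b).
Proof.
move=> [x1 x2] [y1 y2] xy.
by move: (congr1 snd xy) (congr1 fst xy) => /= <- /addrI ->.
Qed.

Definition cf_perm b : {perm 'Z_e * 'Z_e} := perm (@cf_step_inj b).

(** Permutations compose with the left factor acting first, so the product in reading order applies
    the step of a_(m+1) first. *)
Lemma cf_perm_pair (a : nat -> nat) x m n :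
  (\prod_(0 <= j < n) cf_perm (a (m + 1 + j)%N))%g
    ((cf_pair a x m).1%:R, (cf_pair a x m).2%:R) =
  ((cf_pair a x (m + n)%N).1%:R, (cf_pair a x (m + n)%N).2%:R).
Proof.
elim: n => [|n IHn]; first by rewrite big_geq // perm1 addn0.
rewrite big_nat_recr //= permM IHn permE /cf_step addn1 (addnS m) addSn /=.
by rewrite natrD natrM.
Qed.

End CfStepPerm.

Lemma cf_pair_recurrent_mod (a : nat -> nat) (x : nat * nat) (m e K : nat) :
  (1 < e)%N -> recurrent (fun i => a (m + 1 + i)%N) ->
  exists2 n, (K <= n)%N &
    (cf_pair a x (m + n)%N).1 = (cf_pair a x m).1 %[mod e] /\
    (cf_pair a x (m + n)%N).2 = (cf_pair a x m).2 %[mod e].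
Proof.
move=> e1 arec; have [n Kn prod1] := recurrent_prod1 (@cf_perm e) K arec.
exists n => //; have := cf_perm_pair e a x m n; rewrite prod1 perm1.
move=> xy; have := congr1 (val \o snd) xy; have := congr1 (val \o fst) xy.
(* ['Z_e] is Z/e only for [1 < e]; otherwise it is Z/2. *)
by rewrite /= !val_Zp_nat.
Qed.

(** * Growth, coprimality and determinant of continuants *)

Section Continuants.
Variable a : nat -> nat.
Hypothesis a_gt0 : forall k : nat, (1 <= k)%N -> (1 <= a k)%N.

Lemma qpair1_gt0 n : (0 < (qpair a n).1)%N.
Proof. by elim: n => //= n IHn; rewrite addn_gt0 muln_gt0 a_gt0 // IHn. Qed.

Lemma qpair_le n : ((qpair a n).2 <= (qpair a n).1)%N.
Proof.
case: n => //= n; rewrite (leq_trans _ (leq_addr _ _)) //.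
by rewrite leq_pmull // a_gt0.
Qed.

(** At n = 0 strictness fails when a_1 = 1, since then q_0 = q_1 = 1. *)
Lemma qpair1_ltS n : (0 < n)%N -> ((qpair a n).1 < (qpair a n.+1).1)%N.
Proof.
case: n => // n _; rewrite -addn1 /= leq_add //; last exact: qpair1_gt0.
by rewrite leq_pmull // a_gt0.
Qed.

Lemma qpair1_ge n : (n <= (qpair a n).1)%N.
Proof.
elim: n => // -[|n] IHn; first exact: qpair1_gt0.
by rewrite (leq_ltn_trans IHn) // qpair1_ltS.
Qed.

Lemma qpair_coprime n : coprime (qpair a n).1 (qpair a n).2.
Proof. by elim: n => //= n IHn; rewrite coprime_sym /coprime gcdnMDl. Qed.

(** Each step flips the sign of the determinant; the absolute value avoids tracking parity. *)
Lemma cf_pair_det (R : numDomainType) n :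
  `|(ppair a n).1%:R * (qpair a n).2%:R - (ppair a n).2%:R * (qpair a n).1%:R|
  = 1 :> R.
Proof.
elim: n => [|n IHn] /=; first by rewrite mul0r sub0r mulr1 normrN1.
rewrite -[RHS]IHn -normrN; congr `|_|; rewrite !natrD !natrM; ring.
Qed.

End Continuants.

(** * Convergence and approximation by convergents *)

Section CfracApprox.
Variables (R : realType) (a : nat -> nat).
Hypothesis a_gt0 : forall k : nat, (1 <= k)%N -> (1 <= a k)%N.

(** This is [0; a_m, ..., a_(m+n-1)]: the second index is a length. *)
Let c m n : R := fin_cfrac R [seq a k | k <- iota m n].

Lemma fin_cfrac_iota_ge0 m n : 0 <= c m n.
Proof.
rewrite /c; elim: n m => //= n IHn m.
by rewrite invr_ge0 addr_ge0 // IHn.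
Qed.

Lemma fin_cfrac_iota_le1 m n : (0 < m)%N -> c m n <= 1.
Proof.
case: n => [|n] m0; first exact: ler01.
rewrite /c /= invf_le1; last by rewrite ltr_pwDl ?fin_cfrac_iota_ge0 // ltr0n a_gt0.
by rewrite (@le_trans _ _ (a m)%:R) ?ler1n ?a_gt0 // lerDl fin_cfrac_iota_ge0.
Qed.

(** The Moebius formula (p_n + x p_(n-1)) / (q_n + x q_(n-1)) with tail x, cleared of denominators.
    The induction absorbs one letter by writing x = 1 / (a_(n+1) + x'). *)
Lemma fin_cfrac_tail n k (x := c n.+1 k) :
  c 1 (n + k)%N * ((qpair a n).1%:R + x * (qpair a n).2%:R) =
  (ppair a n).1%:R + x * (ppair a n).2%:R.
Proof.
rewrite {}/x; elim: n k => [|n IHn] k.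
  by rewrite add0n /= !mulr1n !mulr0n mulr0 addr0 add0r !mulr1.
rewrite addSnnS; have := IHn k.+1.
move: (c 1 (n + k.+1)) => y.
have -> : c n.+1 k.+1 = ((a n.+1)%:R + c n.+2 k)^-1 by [].
have := fin_cfrac_iota_ge0 n.+2 k; move: (c n.+2 k) => x x0 H.
have D0 : (a n.+1)%:R + x != 0 :> R.
  by rewrite gt_eqF // ltr_pwDl ?ltr0n ?a_gt0.
rewrite /= !natrD !natrM.
transitivity (((a n.+1)%:R + x) *
    (y * ((qpair a n).1%:R + ((a n.+1)%:R + x)^-1 * (qpair a n).2%:R))).
  by field.
by rewrite H; field.
Qed.

(** Multiplied by q_n + x q_(n-1) >= q_n, the two errors become, up to sign, x and 1 times the
    determinant, with 0 <= x <= 1. *)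
Lemma fin_cfrac_approx n k : (n <= k)%N ->
  `|(qpair a n).1%:R * c 1 k - (ppair a n).1%:R| <= (qpair a n).1%:R^-1 /\
  `|(qpair a n).2%:R * c 1 k - (ppair a n).2%:R| <= (qpair a n).1%:R^-1.
Proof.
move=> nk; have := fin_cfrac_tail n (k - n); rewrite subnKC //.
have := fin_cfrac_iota_ge0 n.+1 (k - n).
have := @fin_cfrac_iota_le1 n.+1 (k - n) isT.
have := cf_pair_det a R n.
have : 0 < (qpair a n).1%:R :> R by rewrite ltr0n qpair1_gt0.
have : 0 <= (qpair a n).2%:R :> R by [].
move: (c 1 k) (c n.+1 _) => y x.
move: (_.1%:R) (_.2%:R) (_.1%:R) (_.2%:R) => p p' q q' q'0 q0 det x1 x0 /= H.
have qD : q <= q + x * q' by rewrite lerDl mulr_ge0.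
have D0 : 0 < q + x * q' by exact: lt_le_trans qD.
have bound z : `|z| * (q + x * q') <= 1 -> `|z| <= q^-1.
  by move=> zD; rewrite -[leRHS]mul1r ler_pdivlMr // (le_trans _ zD) // ler_wpM2l.
split; apply: bound; rewrite -(gtr0_norm D0) -normrM.
  have -> : (q * y - p) * (q + x * q') = - (x * (p * q' - p' * q)).
    by rewrite mulrBl -mulrA H; ring.
  by rewrite normrN normrM det mulr1 ger0_norm.
have -> : (q' * y - p') * (q + x * q') = p * q' - p' * q.
  by rewrite mulrBl -mulrA H; ring.
by rewrite det.
Qed.

(** Gives content to the [limn] in [cfrac]: from index n on, all convergents lie within 1/q_n^2 of
    p_n/q_n, and q_n is unbounded. *)
Lemma cfrac_cvg : c 1 @ \oo --> cfrac R a.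
Proof.
apply/cauchy_cvgP/cauchy_exP => e e0 /=.
have [n qe] : exists n, e^-1 < (qpair a n).1%:R.
  exists (Num.bound e^-1); apply: lt_le_trans (archi_boundP _) _; first by rewrite invr_ge0 ltW.
  by rewrite ler_nat qpair1_ge.
have q0 : 0 < (qpair a n).1%:R :> R by rewrite ltr0n qpair1_gt0.
exists ((ppair a n).1%:R / (qpair a n).1%:R); exists n => // k /= nk.
rewrite -ball_normE /= distrC; have [+ _] := fin_cfrac_approx nk.
set q := (qpair a n).1%:R; set p := (ppair a n).1%:R => H.
have -> : c 1 k - p / q = (q * c 1 k - p) / q.
  by rewrite mulrBl mulrAC mulfV ?mul1r // gt_eqF.
rewrite normrM normfV (gtr0_norm q0) ltr_pdivrMr //.
rewrite (le_lt_trans H) // (@lt_le_trans _ _ e) //.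
  by rewrite -[ltRHS]invrK ltf_pV2 ?posrE ?invr_gt0.
by rewrite ler_peMr ?(ltW e0) // ler1n qpair1_gt0.
Qed.

Lemma cfrac_approx n :
  `|(qpair a n).1%:R * cfrac R a - (ppair a n).1%:R| <= (qpair a n).1%:R^-1 /\
  `|(qpair a n).2%:R * cfrac R a - (ppair a n).2%:R| <= (qpair a n).1%:R^-1.
Proof.
have lim_le (q p b : R) : (\forall k \near \oo, `|q * c 1 k - p| <= b) ->
    `|q * cfrac R a - p| <= b.
  move=> ub; apply: (closed_cvg (fun z => z <= b) (@closed_le _ b) ub).
  apply: cvg_norm; apply: cvgB; last exact: cvg_cst.
  by apply: cvgM; [exact: cvg_cst|exact: cfrac_cvg].
by split; apply: lim_le; exists n => // k /= nk; have [] := fin_cfrac_approx nk.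
Qed.

End CfracApprox.

(** * Bounds for [dist_int], [absD] and [eprod] *)

Lemma dist_int_ge0 (R : realType) (x : R) : 0 <= dist_int x.
Proof.
apply: lb_le_inf; first by exists `|x - 0%:~R|, 0.
by move=> _ [z _ <-].
Qed.

Lemma dist_int_le (R : realType) (x : R) (z : int) : dist_int x <= `|x - z%:~R|.
Proof. by apply: ge_inf; [exists 0 => _ [? _ <-]|exists z]. Qed.

Lemma absD_ge0 (R : realType) d q : 0 <= absD R d q.
Proof.
apply: lb_le_inf; last by move=> _ [n _ <-]; rewrite invr_ge0.
by exists (eprod d 0)%:R^-1, 0%N => //=; rewrite /eprod big_geq.
Qed.

Lemma absD_le (R : realType) d q n :
  (eprod d n %| q)%N -> absD R d q <= (eprod d n)%:R^-1.
Proof.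
by move=> dq; apply: ge_inf; [exists 0 => _ [? _ <-]; rewrite invr_ge0|exists n].
Qed.

Lemma eprod_gt (d : nat -> nat) n :
  (forall k : nat, (1 <= k)%N -> (2 <= d k)%N) -> (n < eprod d n)%N.
Proof.
move=> d_ge2; elim: n => [|n IHn]; first by rewrite /eprod big_geq.
rewrite /eprod big_nat_recr //= -/(eprod d n).
rewrite (leq_trans _ (leq_mul IHn (d_ge2 n.+1 isT))) //.
by rewrite muln2 -addnn addSn ltnS addnS ltnS leq_addr.
Qed.

Lemma nat_dist_mod (R : numDomainType) (e x y : nat) :
  x = y %[mod e] -> x != y ->
  exists q, [/\ (0 < q)%N, (e %| q)%N & q%:R = `|x%:R - y%:R| :> R].
Proof.
wlog xy : x y / (y < x)%N => [W xyE xNy|xyE _].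
  have [xy|yx|/eqP] := ltngtP x y; last by rewrite (negPf xNy).
    by rewrite distrC; apply: W; rewrite // eq_sym.
  exact: W.
exists (x - y)%N; rewrite subn_gt0 xy -eqn_mod_dvd ?(ltnW xy) // xyE eqxx.
by split=> //; rewrite natrB ?(ltnW xy) // ger0_norm // subr_ge0 ler_nat ltnW.
Qed.

(** * Good multiples of e, and the conclusion *)

Lemma exists_dvd_approx (R : realType) (a : nat -> nat) (m e : nat) :
  (forall k : nat, (1 <= k)%N -> (1 <= a k)%N) ->
  recurrent (fun i : nat => a (m + 1 + i)%N) -> (1 < e)%N ->
  exists q, [/\ (0 < q)%N, (e %| q)%N &
    q%:R * dist_int (q%:R * cfrac R a) <=
      ((qpair a m).1%:R + (qpair a m).2%:R) ^+ 2].
Proof.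
move=> a_gt0 arec e1.
(* Asking for n > q_m forces q_(m+n) > q_m, because q_k >= k. *)
have [n Kn [E1 E2]] := cf_pair_recurrent_mod (1, 0)%N (qpair a m).1.+1 e1 arec.
have := qpair_coprime a (m + n); have := qpair_le a_gt0 (m + n).
have := cfrac_approx R a_gt0 (m + n).
have lt_qm : ((qpair a m).1 < (qpair a (m + n)).1)%N.
  by rewrite (leq_trans Kn) // (leq_trans (leq_addl m n)) // qpair1_ge.
have := qpair1_gt0 a_gt0 m.
move: lt_qm E1 E2; move: (qpair a m) (qpair a (m + n)) => [u u'] [v v'] /=.
move: (ppair a (m + n)) => [p p'] /= uv E1 E2 u0 [A1 A2] v'v cop.
have [||q [q0 eq qE]] := @nat_dist_mod R e (u * v') (u' * v).
(* Modulo e, both products are u u'. *)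
- by rewrite -modnMmr E2 modnMmr -[RHS]modnMmr E1 modnMmr mulnC.
(* Equality would make v divide u v', hence u, although 0 < u < v. *)
- apply/negP => /eqP uvE; have : (v %| u * v')%N by rewrite uvE dvdn_mull.
  by rewrite Gauss_dvdl // => /(dvdn_leq u0); rewrite leqNgt uv.
exists q; split=> //.
have v0 : 0 < v%:R :> R by rewrite ltr0n (leq_ltn_trans _ uv).
rewrite !natrM in qE.
have qv : q%:R <= (u%:R + u'%:R) * v%:R :> R.
  rewrite qE (le_trans (ler_normB _ _)) // !ger0_norm // mulrDl lerD2r.
  by rewrite ler_wpM2l // ler_nat.
(* The factor v in the bound for q cancels against 1/v here, leaving a bound independent of e. *)
have dv : dist_int (q%:R * cfrac R a) <= (u%:R + u'%:R) / v%:R.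
  (* The integer is u p' - u' p, with the sign of u v' - u' v. *)
  have [z zE] : exists z : int,
      `|q%:R * cfrac R a - z%:~R| =
      `|u%:R * (v'%:R * cfrac R a - p'%:R) - u'%:R * (v%:R * cfrac R a - p%:R)|.
    rewrite qE; have [_|_] := ger0P (u%:R * v'%:R - u'%:R * v%:R : R).
      exists (u%:Z * p'%:Z - u'%:Z * p%:Z).
      by congr `|_|; rewrite rmorphB !rmorphM /=; ring.
    exists (u'%:Z * p%:Z - u%:Z * p'%:Z); rewrite -normrN.
    by congr `|_|; rewrite rmorphB !rmorphM /=; ring.
  apply: (le_trans (dist_int_le _ z)).
  rewrite zE (le_trans (ler_normB _ _)) // !normrM !normr_nat mulrDl.
  by rewrite lerD // ler_wpM2l.
apply: (le_trans (ler_pM _ _ qv dv)) => //; first exact: dist_int_ge0.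
by rewrite mulrACA mulfV ?mulr1 ?gt_eqF.
Qed.

Theorem theorem2p3 (R : realType) (a : nat -> nat)
    (a_gt0 : forall k : nat, (1 <= k)%N -> (1 <= a k)%N)
    (a_rec : exists m : nat, recurrent (fun i : nat => a (m + 1 + i)%N))
    (d : nat -> nat) (d_ge2 : forall k : nat, (1 <= k)%N -> (2 <= d k)%N) :
  let alpha : R := cfrac R a in
  ereal_inf [set (q%:R * dist_int (q%:R * alpha) * absD R d q)%:E
            | q in [set q : nat | (1 <= q)%N]] = 0%E.
Proof.
move=> alpha; have [m arec] := a_rec.
apply/eqP; rewrite eq_le; apply/andP; split; last first.
  apply: le_ereal_inf_tmp => _ [q _ <-].
  by rewrite lee_fin !mulr_ge0 ?dist_int_ge0 ?absD_ge0.
apply/lee_addgt0Pr => eps eps0; rewrite add0e.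
pose C : R := ((qpair a m).1%:R + (qpair a m).2%:R) ^+ 2.
(* Then e_n > n > C / eps; the successor ensures n >= 1, hence e_n > 1. *)
pose n := (Num.bound (C / eps)).+1.
have e_gt : (n < eprod d n)%N by exact: eprod_gt.
have [|q [q0 dq qC]] := @exists_dvd_approx R a m (eprod d n) a_gt0 arec.
  exact: leq_ltn_trans e_gt.
apply: ereal_inf_le; exists (q%:R * dist_int (q%:R * alpha) * absD R d q)%:E.
  by exists q.
rewrite lee_fin.
have e0 : 0 < (eprod d n)%:R :> R by rewrite ltr0n (leq_ltn_trans _ e_gt).
apply: (@le_trans _ _ (C / (eprod d n)%:R)).
  by rewrite ler_pM ?mulr_ge0 ?dist_int_ge0 ?absD_ge0 ?absD_le.
rewrite ler_pdivrMr // mulrC -ler_pdivrMr //.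
apply: le_trans (ltW (archi_boundP _)) _; first by rewrite divr_ge0 ?sqr_ge0 ?ltW.
by rewrite ler_nat (leq_trans (leqnSn _)) // ltnW.
Qed.
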